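(* Let $G$ be an infinite finitely generated group, let $\mu$ be a finitely supported, symmetric, non-degenerate probability measure on $G$, let $S=\operatorname{supp}\mu$, and let $(Z_n)$ be the $\mu$-random walk on $G$. Let $f\colon\mathbb{N}\to\mathbb{N}$ be a monotone increasing function and $c>0$ a constant such that $$\mathbb{P}\big[Z_n\in B_{f(n)}(G,S)\big]>c\quad\text{for all } n.$$ Then, for every $r\in\mathbb{N}$ for which $\{k\in\mathbb{N}: f(k)\le r\}$ is nonempty, $$\mathfrak{C}_{G,S}(r)\;\ge\;\frac{c\,\min\mu}{4}\sqrt{f^*(r)},\qquad\text{where } f^*(r)=\max\{k\in\mathbb{N}: f(k)\le r\}.$$
   Context: A probability measure $\mu$ on $G$ is symmetric if $\mu(g)=\mu(g^{-1})$ for all $g$, and non-degenerate if its support generates $G$ as a semigroup. $\min\mu=\min\{\mu(g):\mu(g)>0\}$. The $\mu$-random walk is $Z_n=X_1X_2\cdots X_n$, where $X_1,X_2,\dots$ are i.i.d. with distribution $\mu$. For a finite symmetric generating set $S$ of $G$, $|g|_S$ is the word length of $g$ with respect to $S$, and $B_r(G,S)=\{g\in G:|g|_S\le r\}$. A coset of infinite index (c.i.i.) of $G$ is a set $C=Hg$ with $g\in G$ and $H\le G$ a subgroup of infinite index. The coset covering function of $(G,S)$ is $$\mathfrak{C}_{G,S}(r)=\min\Big\{N:\ \exists \text{ c.i.i.s } C_1,\dots,C_N \text{ of } G \text{ with } B_r(G,S)\subseteq \bigcup_{i=1}^N C_i\Big\}.$$ The cosets may be cosets of different subgroups. ''Monotone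 increasing'' means non-decreasing. *)

(* Defs.v *)
From HB Require Import structures.
From mathcomp Require Import all_boot all_order all_algebra finmap.
From mathcomp Require Import all_classical all_reals all_analysis.

Set Implicit Arguments.
Unset Strict Implicit.
Unset Printing Implicit Defensive.

Import Order.TTheory GRing.Theory Num.Theory.

Local Open Scope classical_set_scope.
Local Open Scope ring_scope.

(* The default value [x0] is used only when [A] has no minimum. Each use below
   is on a set that has one in the setting of the theorem: a nonempty set of
   natural numbers, or a nonempty finite set of reals. *)
Definition is_min {d} {T : porderType d} (A : set T) : set T := A `&` lbound A.
Definition is_max {d} {T : porderType d} (A : set T) : set T := A `&` ubound A.
Definition set_min {d} {T : porderType d} (x0 : T) (A : set T) : T :=
  xget x0 (is_min A).

Lemma set_min_nat (A : set nat) : A !=set0 -> is_min A (set_min 0%N A).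
Proof.
move=> /nat_has_minimum [j [Aj jmin]].
by apply: xgetPex; exists j; split => // k /jmin; rewrite leEnat.
Qed.

Section Groups.
Variable G : groupType.
Implicit Types (H S C : set G) (g : G) (s : seq G).

Definition is_subgroup H : Prop := group_closed (mem H).

Definition finitely_generated : Prop :=
  exists2 S : set G, finite_set S &
    forall H, is_subgroup H -> S `<=` H -> H = setT.

Definition is_word S s g : Prop := [set` s] `<=` S /\ (\prod_(x <- s) x)%g = g.

Definition generates_as_semigroup S : Prop :=
  forall g, exists2 s, s <> [::] & is_word S s g.

(* Words use letters of S only (not inverses): S is meant to be symmetric. *)
Definition word_length S g : nat :=
  set_min 0%N [set size s | s in [set s | is_word S s g]].

Definition word_ball S (r : nat) : set G := [set g | (word_length S g <= r)%N].

Definition right_coset H g : set G := [set (h * g)%g | h in H].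

Definition infinite_index H : Prop := infinite_set (range (right_coset H)).

Definition is_cii C : Prop :=
  exists H g, [/\ is_subgroup H, infinite_index H & C = right_coset H g].

Definition coset_covering S (r : nat) : nat :=
  set_min 0%N [set N | exists C : 'I_N -> set G,
    (forall i, is_cii (C i)) /\ word_ball S r `<=` \bigcup_i C i].

End Groups.

Section Measures.
Variables (R : realType) (G : groupType).
Implicit Types mu : G -> R.

Definition supp mu : set G := [set g | 0 < mu g].

(* A finitely supported probability measure on the discrete group G, given by
   its values on points. Finiteness of the support is needed for the finitely
   supported sum to be the actual total mass. *)
Definition is_finsupp_prob mu : Prop :=
  [/\ forall g, 0 <= mu g, finite_set (supp mu) & \sum_(g \in supp mu) mu g = 1].

Definition symmetric_mass mu : Prop := forall g, mu g = mu g^-1%g.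

Definition nondegenerate_mass mu : Prop := generates_as_semigroup (supp mu).

Definition min_mass mu : R := set_min 0 [set mu g | g in supp mu].

End Measures.

Section RandomWalk.
Context {d : measure_display} {Omega : measurableType d} {R : realType}
        (G : groupType).
Variable P : probability Omega R.
Implicit Types (X : nat -> Omega -> G) (mu : G -> R).

(* G carries the discrete sigma-algebra: every preimage is an event. *)
Definition discrete_random_variables X : Prop :=
  forall n (A : set G), measurable (X n @^-1` A).

Definition independent_variables X : Prop :=
  forall (J : {fset nat}) (A : nat -> set G),
    P (\bigcap_(j in [set` J]) (X j @^-1` A j)) =
    (\prod_(j <- J) P (X j @^-1` A j))%E.

Definition iid_with_law mu X : Prop :=
  [/\ discrete_random_variables X,
      forall n g, P (X n @^-1` [set g]) = (mu g)%:E &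
      independent_variables X].

End RandomWalk.

(* The steps are indexed from 0: X 0 is the first factor of Z_n. *)
Definition random_walk {Omega : Type} {G : groupType} (X : nat -> Omega -> G)
    (n : nat) (w : Omega) : G := (\prod_(i < n) X i w)%g.

(* Main.v *)
Require Import Defs.
From mathcomp Require Import all_boot all_order all_algebra finmap.
From mathcomp Require Import all_classical all_reals all_analysis.
From mathcomp Require Import ring lra zify.

(** A coset of a subgroup of infinite index is hit at time [n] with probability
at most [4 / (min_mass mu * sqrt n)] ([cii_probability_le]). This gives the
theorem at once: if [f n <= r], then the ball of radius [r] carries more than
[c] of the law of [Z_n], while [N] cosets that cover it carry at most
[4 * N / (min_mass mu * sqrt n)]. The same inequality bounds every [n] with
[f n <= r], so that the maximum [f^*(r)] exists.

The walk on the group projects to a walk on the right cosets of [H], which form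
an infinite connected graph with symmetric transition weights, and the bound is
the decay of such a walk at the rate of the line ([walk_law_decay]). Let [phi] be
the law of the projected walk at time [m] and [u] the sum of its squares. One
step decreases [u] by an energy, a weighted sum of squared differences of [phi]
over pairs of points two steps apart ([energy_identity]). From any point an even
number of steps leads outside the finite support of [phi]; telescoping the
squares of [phi] along a path of such double steps bounds [(phi x)^2], up to a
factor that depends on the weights, by the geometric mean of the energy and [u]
([sup_norm_energy]). As [phi] has mass one, [u] is at most the maximum of [phi],
so the energy is at least [kappa^2 * u^3 / 8], where [kappa] is the least weight
([return_mass_decay]), and this recursion forces [u <= 2 / (kappa * sqrt m)]. By self-adjointness the probability of going from
[x] to [y] in [i + j] steps is the inner product of the laws at times [i] and
[j] started at [x] and [y], so it is controlled by the two sums of squares.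

Cosets are handled as elements of the type of all subsets of the group, on which
the group acts by right translation; the orbit of [H] is the coset space. *)

Set Implicit Arguments.
Unset Strict Implicit.
Unset Printing Implicit Defensive.

Import Order.TTheory GRing.Theory Num.Theory.
Local Open Scope classical_set_scope.
Local Open Scope ring_scope.

(** * Sums of finitely supported functions *)

Section FiniteSupportSums.
Context {R : realType} {V : choiceType}.
Implicit Types (F K : V -> R) (A : {fset V}).

Definition finitely_supported F : Prop :=
  exists A : {fset V}, forall v, v \notin A -> F v = 0.

Definition fsumT F : R := \sum_(v \in [set: V]) F v.

Lemma fsumTE A F : (forall v, v \notin A -> F v = 0) ->
  fsumT F = \sum_(v <- A) F v.
Proof. exact: fsbigTE. Qed.

Lemma eq_fsumT F K : (forall v, F v = K v) -> fsumT F = fsumT K.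
Proof. by move=> FK; apply: eq_fsbigr => v _; exact: FK. Qed.

Lemma fsumTD F K : finitely_supported F -> finitely_supported K ->
  fsumT (fun v => F v + K v) = fsumT F + fsumT K.
Proof.
move=> [A FA] [B KB].
have FU v : v \notin (A `|` B)%fset -> F v = 0.
  by rewrite in_fsetU negb_or => /andP[/FA].
have KU v : v \notin (A `|` B)%fset -> K v = 0.
  by rewrite in_fsetU negb_or => /andP[_ /KB].
rewrite (fsumTE FU) (fsumTE KU) (@fsumTE (A `|` B)%fset) ?big_split//.
by move=> v vU; rewrite FU// KU// addr0.
Qed.

Lemma fsumT_scale a F : fsumT (fun v => a * F v) = a * fsumT F.
Proof. by rewrite /fsumT mulr_fsumr. Qed.

Lemma fsumT_sum (I : eqType) (s : seq I) (F : I -> V -> R) :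
  (forall i, finitely_supported (F i)) ->
  finitely_supported (fun v => \sum_(i <- s) F i v) /\
  fsumT (fun v => \sum_(i <- s) F i v) = \sum_(i <- s) fsumT (F i).
Proof.
move=> fF; elim: s => [|i s [[A sA] IH]].
  split; first by exists fset0 => v _; rewrite big_nil.
  rewrite big_nil -[RHS](mul0r (fsumT (fun=> 0))) -fsumT_scale.
  by apply: eq_fsumT => v; rewrite big_nil mul0r.
split.
  have [B iB] := fF i; exists (A `|` B)%fset => v.
  rewrite in_fsetU negb_or => /andP[vA vB].
  by rewrite big_cons sA// iB// addr0.
rewrite big_cons -IH -fsumTD//; last by exists A.
by apply: eq_fsumT => v; rewrite big_cons.
Qed.

Lemma fsumT_reindex (h h' : V -> V) F : cancel h h' -> cancel h' h ->
  fsumT (F \o h) = fsumT F.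
Proof.
move=> hK h'K; have hb : bijective h by exists h'.
by apply/esym/reindex_fsbigT.
Qed.

Lemma fsumT_ge0 F : (forall v, 0 <= F v) -> 0 <= fsumT F.
Proof. by move=> F0; apply: fsumr_ge0. Qed.

Lemma ler_fsumT F K : finitely_supported F -> finitely_supported K ->
  (forall v, F v <= K v) -> fsumT F <= fsumT K.
Proof.
move=> [A FA] fK FK.
have fN : finitely_supported (fun v => -1 * F v).
  by exists A => v /FA ->; rewrite mulr0.
rewrite -subr_ge0 -[- fsumT F]mulN1r -fsumT_scale -fsumTD//.
by apply: fsumT_ge0 => v; rewrite mulN1r subr_ge0.
Qed.

Lemma sum_uniq_le_fsumT F (s : seq V) : finitely_supported F ->
  (forall v, 0 <= F v) -> uniq s -> \sum_(v <- s) F v <= fsumT F.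
Proof.
move=> [A FA] F0 us.
have FU v : v \notin (A `|` [fset x in s])%fset -> F v = 0.
  by rewrite in_fsetU negb_or => /andP[/FA].
rewrite (fsumTE FU) (big_fsetID _ (mem s))/= -[leLHS]addr0 lerD//; last first.
  exact: sumr_ge0.
rewrite le_eqVlt; apply/orP; left; apply/eqP/perm_big/uniq_perm => // v.
by rewrite !inE/= andb_orl andbb orbC; case: (v \in s); rewrite ?andbF.
Qed.

End FiniteSupportSums.

(** * Decay of a symmetric walk on an infinite orbit *)

Section Walk.
Context {R : realType} {V : choiceType} {G : groupType}.
Variable act : V -> G -> V.
Hypothesis act1 : forall v, act v 1%g = v.
Hypothesis actM : forall v g h, act v (g * h)%g = act (act v g) h.
Variables (mu : G -> R) (letters : seq G).

(** The variable is moved by the inverse letter, so that this is the step on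
laws: the new mass at [v] comes from the points that a letter sends to [v]. *)
Definition walk_step (phi : V -> R) (v : V) : R :=
  \sum_(s <- letters) mu s * phi (act v s^-1%g).

Definition point_mass (x v : V) : R := (v == x)%:R.

Definition walk_law (n : nat) (x : V) : V -> R :=
  iter n walk_step (point_mass x).

Local Notation fs := (@finitely_supported R V).

Lemma translateK g : cancel (act^~ g) (act^~ g^-1%g).
Proof. by move=> v; rewrite -actM mulgV act1. Qed.

Lemma translateKV g : cancel (act^~ g^-1%g) (act^~ g).
Proof. by move=> v; rewrite -actM mulVg act1. Qed.

Lemma fsumT_act g (F : V -> R) : fsumT (fun v => F (act v g)) = fsumT F.
Proof. exact: (fsumT_reindex F (translateK g) (translateKV g)). Qed.

Lemma fs_act g (F : V -> R) : fs F -> fs (fun v => F (act v g)).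
Proof.
move=> [A FA]; exists [fset act v g^-1%g | v in A]%fset => v vA.
apply: FA; apply: contra vA => vA; apply/imfsetP; exists (act v g) => //=.
by rewrite translateK.
Qed.

Lemma fs_comp (h : R -> R) (F : V -> R) : h 0 = 0 -> fs F -> fs (h \o F).
Proof. by move=> h0 [A FA]; exists A => v /FA /= ->. Qed.

Lemma fs_mull (F K : V -> R) : fs F -> fs (fun v => F v * K v).
Proof. by move=> [A FA]; exists A => v /FA ->; rewrite mul0r. Qed.

Lemma fs_mulr (F K : V -> R) : fs F -> fs (fun v => K v * F v).
Proof. by move=> [A FA]; exists A => v /FA ->; rewrite mulr0. Qed.

Lemma fs_add (F K : V -> R) : fs F -> fs K -> fs (fun v => F v + K v).
Proof.
move=> [A FA] [B KB]; exists (A `|` B)%fset => v.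
by rewrite in_fsetU negb_or => /andP[/FA -> /KB ->]; rewrite addr0.
Qed.

Lemma fs_sqrB (F K : V -> R) : fs F -> fs K -> fs (fun v => (F v - K v) ^+ 2).
Proof.
move=> [A FA] [B KB]; exists (A `|` B)%fset => v.
by rewrite in_fsetU negb_or => /andP[/FA -> /KB ->]; rewrite subr0 expr0n.
Qed.

Lemma fs_walk_step phi : fs phi -> fs (walk_step phi).
Proof.
by move=> fphi; apply: (fsumT_sum _ _).1 => s; apply/fs_mulr/fs_act.
Qed.

Lemma fs_walk_law n x : fs (walk_law n x).
Proof.
elim: n => [|n IH]; last exact: fs_walk_step.
by exists [fset x]%fset => v; rewrite inE /walk_law/= /point_mass => /negPf ->.
Qed.

Hypothesis mu_ge0 : forall s, 0 <= mu s.
Hypothesis mu_sum : \sum_(s <- letters) mu s = 1.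
Hypothesis mu_sym : forall s, mu s = mu s^-1%g.
Hypothesis letters_uniq : uniq letters.
Hypothesis lettersV : forall s, s \in letters -> s^-1%g \in letters.
Variable kappa : R.
Hypothesis kappa_gt0 : 0 < kappa.
Hypothesis kappa_le : forall s, s \in letters -> kappa <= mu s.
Hypothesis generating :
  forall g, exists w : seq G, all (mem letters) w /\ (\prod_(x <- w) x)%g = g.

Lemma sum_lettersV (F : G -> R) :
  \sum_(s <- letters) F s^-1%g = \sum_(s <- letters) F s.
Proof.
rewrite -(big_map (fun s => s^-1%g) xpredT F); apply/perm_big/uniq_perm => //.
  by rewrite map_inj_uniq//; exact: invg_inj.
move=> s; apply/mapP/idP => [[t tL ->]|sL]; first exact: lettersV.
by exists s^-1%g; rewrite ?invgK ?lettersV.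
Qed.

Lemma walk_law_ge0 n x v : 0 <= walk_law n x v.
Proof.
elim: n v => [|n IH] v; first exact: ler0n.
by apply: sumr_ge0 => s _; apply: mulr_ge0 => //; exact: IH.
Qed.

Lemma fsumT_walk_step phi : fs phi -> fsumT (walk_step phi) = fsumT phi.
Proof.
move=> fphi; rewrite (fsumT_sum _ _).2; last by move=> s; apply/fs_mulr/fs_act.
rewrite -[RHS]mul1r -mu_sum mulr_suml; apply: eq_bigr => s _.
by rewrite fsumT_scale fsumT_act.
Qed.

Lemma fsumT_point_mass phi x : fsumT (fun v => phi v * point_mass x v) = phi x.
Proof.
rewrite (@fsumTE _ _ [fset x]%fset).
  by rewrite big_seq_fset1 /point_mass eqxx mulr1.
by move=> v; rewrite inE /point_mass => /negPf ->; rewrite mulr0.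
Qed.

Lemma fsumT_walk_law n x : fsumT (walk_law n x) = 1.
Proof.
elim: n => [|n IH]; last by rewrite fsumT_walk_step//; exact: fs_walk_law.
rewrite -[RHS](fsumT_point_mass (fun=> 1) x).
by apply: eq_fsumT => v; rewrite mul1r.
Qed.

(** A letter and its inverse have the same weight, and translation by one is
inverse to translation by the other, so each term moves across the pairing. *)
Lemma walk_step_adjoint phi psi : fs phi -> fs psi ->
  fsumT (fun v => walk_step phi v * psi v) =
  fsumT (fun v => phi v * walk_step psi v).
Proof.
move=> fphi fpsi.
transitivity (\sum_(s <- letters)
    mu s * fsumT (fun v => phi (act v s^-1%g) * psi v)).
  under eq_fsumT => v do rewrite /walk_step mulr_suml.
  rewrite (fsumT_sum _ _).2; last by move=> s; apply: fs_mulr.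
  apply: eq_bigr => s _; rewrite -fsumT_scale.
  by apply: eq_fsumT => v; rewrite mulrA.
under [RHS]eq_fsumT => v do rewrite /walk_step mulr_sumr.
rewrite (fsumT_sum _ _).2; last by move=> s; apply: fs_mull.
rewrite -[RHS]sum_lettersV; apply: eq_bigr => s _.
rewrite -(fsumT_act s) -fsumT_scale.
by apply: eq_fsumT => v; rewrite translateK invgK -mu_sym mulrCA.
Qed.

(** All steps of the second factor can be moved to the first one, which leaves
a point mass at [y]. *)
Lemma walk_law_convolution m n x y :
  fsumT (fun v => walk_law m x v * walk_law n y v) = walk_law (n + m) x y.
Proof.
elim: n m => [|n IH] m; first exact: fsumT_point_mass.
rewrite addSnnS -IH /= walk_step_adjoint//; exact: fs_walk_law.
Qed.

(** The local term of the Dirichlet form of two steps of the walk. The sum runs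
over pairs of letters, which avoids collecting two-step transition weights. *)
Definition energy_density (phi : V -> R) (v : V) : R :=
  2^-1 * \sum_(s <- letters) \sum_(t <- letters)
    mu s * mu t * (phi v - phi (act v (s * t^-1)%g)) ^+ 2.

Lemma energy_density_ge0 phi v : 0 <= energy_density phi v.
Proof.
rewrite mulr_ge0// sumr_ge0// => s _; apply: sumr_ge0 => t _.
by rewrite mulr_ge0 ?sqr_ge0// mulr_ge0.
Qed.

Lemma fs_energy_density phi : fs phi -> fs (energy_density phi).
Proof.
move=> fphi; apply/fs_mulr/(fsumT_sum _ _).1 => s; apply: (fsumT_sum _ _).1 => t.
by apply/fs_mulr/fs_sqrB => //; apply: fs_act.
Qed.

(** The variance of a variable is half the mean square difference of two
independent copies. *)
Lemma variance_pairs (a : G -> R) :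
  \sum_(s <- letters) mu s * a s ^+ 2 - (\sum_(s <- letters) mu s * a s) ^+ 2 =
  2^-1 * \sum_(s <- letters) \sum_(t <- letters)
    mu s * mu t * (a s - a t) ^+ 2.
Proof.
set Q := \sum_(s <- letters) mu s * a s ^+ 2.
set L := \sum_(s <- letters) mu s * a s.
suff -> : \sum_(s <- letters) \sum_(t <- letters)
    mu s * mu t * (a s - a t) ^+ 2 = Q *+ 2 - L ^+ 2 *+ 2.
  by field.
transitivity (\sum_(s <- letters) (mu s * a s ^+ 2 - mu s * a s * L *+ 2
    + mu s * Q)).
  apply: eq_bigr => s _.
  rewrite -[mu s * a s ^+ 2]mulr1 -mu_sum /Q /L !mulr_sumr -sumrMnl.
  rewrite -sumrN -!big_split/=; apply: eq_bigr => t _; ring.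
rewrite !big_split/= sumrN sumrMnl -!mulr_suml mu_sum -/Q -/L; ring.
Qed.

(** At each point the loss is the variance of [phi] over the neighbours of that
point; recentring every pair of neighbours at its first member turns the pairs
into points two steps apart. *)
Lemma energy_identity phi : fs phi ->
  fsumT (fun v => phi v ^+ 2) - fsumT (fun v => walk_step phi v ^+ 2) =
  fsumT (energy_density phi).
Proof.
move=> fphi.
have f2 : forall F, fs F -> fs (fun v => F v ^+ 2).
  by move=> F fF; apply: (@fs_comp (fun x => x ^+ 2)); rewrite ?expr0n.
have fQ : fs (walk_step (fun v => phi v ^+ 2)) by apply/fs_walk_step/f2.
rewrite -(fsumT_walk_step (f2 _ fphi)) -[- _]mulN1r -fsumT_scale -fsumTD//;
  last by apply/fs_mulr/f2/fs_walk_step.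
under eq_fsumT => v do rewrite mulN1r variance_pairs.
rewrite !fsumT_scale; congr (_ * _).
rewrite !(fsumT_sum _ _).2; first last.
- move=> s; apply: (fsumT_sum _ _).1 => t.
  by apply/fs_mulr/fs_sqrB; apply: fs_act.
- move=> s; apply: (fsumT_sum _ _).1 => t.
  by apply/fs_mulr/fs_sqrB => //; apply: fs_act.
apply: eq_bigr => s _; rewrite !(fsumT_sum _ _).2; first last.
- by move=> t; apply/fs_mulr/fs_sqrB; apply: fs_act.
- by move=> t; apply/fs_mulr/fs_sqrB => //; apply: fs_act.
apply: eq_bigr => t _; rewrite !fsumT_scale; congr (_ * _).
rewrite -(fsumT_act s); apply: eq_fsumT => v.
by rewrite translateK actM.
Qed.

Definition two_step (v w : V) : bool :=
  has (fun s => has (fun t => w == act v (s * t^-1)%g) letters) letters.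

Lemma energy_density_ge phi v w : two_step v w ->
  2^-1 * kappa ^+ 2 * (phi v - phi w) ^+ 2 <= energy_density phi v.
Proof.
move=> /hasP[s sL /hasP[t tL /eqP ->]].
rewrite -mulrA ler_wpM2l// (bigD1_seq s)//= (bigD1_seq t)//= -addrA.
rewrite -[leLHS]addr0 lerD//.
  by rewrite ler_wpM2r ?sqr_ge0// expr2 ler_pM ?kappa_le// ltW.
apply: addr_ge0; apply: sumr_ge0 => i _.
  by rewrite mulr_ge0 ?sqr_ge0// mulr_ge0.
by apply: sumr_ge0 => j _; rewrite mulr_ge0 ?sqr_ge0// mulr_ge0.
Qed.

(** Telescoping the square of [phi] along a path, where each difference of
squares is split by the arithmetic-geometric inequality with weight [l]. *)
Lemma path_energy phi l x p : 0 < l -> path two_step x p ->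
  phi x ^+ 2 - phi (last x p) ^+ 2 <=
  2 * l / kappa ^+ 2 * (\sum_(v <- belast x p) energy_density phi v)
  + (2 * l)^-1 * (\sum_(v <- belast x p) phi v ^+ 2 + \sum_(v <- p) phi v ^+ 2).
Proof.
move=> l0; elim: p x => [|y p IH] x/=.
  by rewrite !big_nil subrr mulr0 addr0 mulr0 addr0.
move=> /andP[/(energy_density_ge phi) xy /IH {}IH].
rewrite !big_cons.
set D := energy_density phi x in xy *.
have kappa2 : 0 < kappa ^+ 2 by rewrite exprn_gt0.
have h1 : l * (phi x - phi y) ^+ 2 <= 2 * l / kappa ^+ 2 * D.
  have -> : l * (phi x - phi y) ^+ 2 =
      2 * l / kappa ^+ 2 * (2^-1 * kappa ^+ 2 * (phi x - phi y) ^+ 2).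
    by field; rewrite gt_eqF.
  by rewrite ler_wpM2l// divr_ge0 ?mulr_ge0 ?ltW.
have h2 : phi x ^+ 2 - phi y ^+ 2 <=
    l * (phi x - phi y) ^+ 2 + (2 * l)^-1 * (phi x ^+ 2 + phi y ^+ 2).
  rewrite -subr_ge0.
  have -> : l * (phi x - phi y) ^+ 2 + (2 * l)^-1 * (phi x ^+ 2 + phi y ^+ 2)
      - (phi x ^+ 2 - phi y ^+ 2) =
    (4 * l)^-1 * (2 * l * (phi x - phi y) - (phi x + phi y)) ^+ 2
      + (4 * l)^-1 * (phi x - phi y) ^+ 2.
    by field; rewrite gt_eqF.
  by rewrite addr_ge0// mulr_ge0 ?sqr_ge0// invr_ge0 mulr_ge0// ltW.
by move: IH h1 h2; rewrite !mulrDr; lra.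
Qed.

(** A word of even length is cut into pairs of letters; the second letter of a
pair is the inverse of a letter by symmetry. *)
Lemma even_word_path x (w : seq G) : all (mem letters) w -> ~~ odd (size w) ->
  exists p, path two_step x p /\ last x p = act x (\prod_(g <- w) g)%g.
Proof.
(* Strong induction on the length, as two letters are removed at a time. *)
move: {2}(size w) (leqnn (size w)) => n; elim: n w x => [|n IH] w x.
  by case: w => // _ _ _; exists [::]; rewrite big_nil act1.
case: w => [|s [|t w]]//= sz; first by exists [::]; rewrite big_nil act1.
move=> /and3P[sL tL wL]; rewrite negbK => ow.
have [|p [pp lp]] := IH w (act x (s * t)%g) _ wL ow; first lia.
exists (act x (s * t)%g :: p); split; last by rewrite /= lp !big_cons !actM.
rewrite /= pp andbT; apply/hasP; exists s => //; apply/hasP; exists t^-1%g.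
  exact: lettersV.
by rewrite invgK.
Qed.

Definition walk_orbit x : set V := range (act x).

(** Words of even length reach infinitely many points: right multiplication by
one fixed letter turns an odd word into an even one. *)
Lemma even_word_escape x (A : {fset V}) : infinite_set (walk_orbit x) ->
  exists w : seq G, [/\ all (mem letters) w, ~~ odd (size w) &
    act x (\prod_(g <- w) g)%g \notin A].
Proof.
move=> oinf; apply: contrapT => nesc; apply: oinf.
have evenA w : all (mem letters) w -> ~~ odd (size w) ->
    act x (\prod_(g <- w) g)%g \in A.
  move=> wL ow; apply: contrapT => /negP wA; apply: nesc; by exists w.
have [a aL] : exists a, a \in letters.
  case: (letters) mu_sum => [|a l _]; last by exists a; rewrite mem_head.
  by rewrite big_nil => /eqP; rewrite eq_sym oner_eq0.
apply: (@sub_finite_set _ _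
  [set` (A `|` [fset act v a^-1%g | v in A])%fset]) => [_ [g _ <-]/=|];
  last exact: finite_fset.
have [w [wL <-]] := generating g; rewrite in_fsetU; apply/orP.
have [ow|ow] := boolP (odd (size w)); last by left; exact: evenA.
right; apply/imfsetP; exists (act x (\prod_(g <- rcons w a) g)%g) => /=.
  by apply: evenA; [rewrite all_rcons wL andbT|rewrite size_rcons/= ow].
by rewrite big_rcons/= actM translateK.
Qed.

(** The path runs from [x] out of the support of [phi]. It is shortened to a
path without repetition, so that its partial sums are parts of the full ones. *)
Lemma sup_norm_energy phi x l : 0 < l -> fs phi -> infinite_set (walk_orbit x) ->
  phi x ^+ 2 <= 2 * l / kappa ^+ 2 * fsumT (energy_density phi)
    + l^-1 * fsumT (fun v => phi v ^+ 2).
Proof.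
move=> l0 fphi oinf; have [A phiA] := fphi.
have [w [wL ow wA]] := even_word_escape A oinf.
have [p [pp lp]] := even_word_path x wL ow; rewrite -{}lp in wA.
case/shortenP: pp wA => {p} p pp up _ /phiA lp0.
have := path_energy phi l0 pp; rewrite lp0 expr0n subr0 => /le_trans; apply.
have fs2 : fs (fun v => phi v ^+ 2).
  by apply: (@fs_comp (fun x => x ^+ 2)); rewrite ?expr0n.
have ub : uniq (belast x p) by move: up; rewrite lastI rcons_uniq => /andP[].
have ut : uniq p by case/andP: up.
apply: lerD.
  apply: ler_wpM2l; first by rewrite divr_ge0 ?sqr_ge0// mulr_ge0// ltW.
  apply: sum_uniq_le_fsumT => //; first exact: fs_energy_density.
  exact: energy_density_ge0.
have -> : l^-1 = (2 * l)^-1 * 2 by field; rewrite gt_eqF.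
rewrite -mulrA; apply: ler_wpM2l; first by rewrite invr_ge0 mulr_ge0// ltW.
rewrite mulr_natl mulr2n.
by apply: lerD; apply: sum_uniq_le_fsumT => // v; exact: sqr_ge0.
Qed.

(** By self-adjointness this is the probability of being back at [x] at time
[2 * m]. *)
Definition return_mass m x : R := fsumT (fun v => walk_law m x v ^+ 2).

Lemma return_mass_ge0 m x : 0 <= return_mass m x.
Proof. by apply: fsumT_ge0 => v; exact: sqr_ge0. Qed.

Lemma walk_orbit_act x g : walk_orbit (act x g) = walk_orbit x.
Proof.
apply/seteqP; split => [_ [h _ <-]|_ [h _ <-]].
  by exists (g * h)%g; rewrite ?actM.
by exists (g^-1 * h)%g; rewrite // -actM mulgA mulgV mul1g.
Qed.

(** Makes a bound on the orbit of [x] serve for the maximum of the law. *)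
Lemma walk_law_orbit n x v : walk_law n x v != 0 -> walk_orbit v = walk_orbit x.
Proof.
elim: n v => [|n IH] v.
  by rewrite /walk_law/= /point_mass; case: (v =P x) => [->//|_]; rewrite eqxx.
apply: contra_neqP => ov; apply: big1 => s _.
have [w0|/IH] := eqVneq (walk_law n x (act v s^-1%g)) 0.
  by rewrite -[RHS](mulr0 (mu s)) -w0.
by rewrite walk_orbit_act.
Qed.

(** The Nash inequality of a line, in terms of the lost energy: the square norm
of a probability vector is at most its maximum, and the maximum is controlled
along a path that leaves the support. *)
Lemma return_mass_decay m x : infinite_set (walk_orbit x) ->
  return_mass m.+1 x <= return_mass m x - kappa ^+ 2 * return_mass m x ^+ 3 / 8.
Proof.
move=> oinf; set u := return_mass m x.
have fphi := fs_walk_law m x.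
have E : u - return_mass m.+1 x = fsumT (energy_density (walk_law m x)).
  exact: energy_identity.
set e := fsumT _ in E.
suff : kappa ^+ 2 * u ^+ 3 / 8 <= e by lra.
have u0 : 0 <= u by exact: return_mass_ge0.
have e0 : 0 <= e by apply: fsumT_ge0 => v; exact: energy_density_ge0.
have kappa2 : 0 < kappa ^+ 2 by rewrite exprn_gt0.
have [->|un0] := eqVneq u 0; first by rewrite expr0n mulr0 mul0r.
have up : 0 < u by rewrite lt_def un0.
(* With the weight [2 / u] the second term is half of [u ^+ 2], so that it is
   absorbed by the left-hand side [u ^+ 2]. *)
set b := 2 * (2 / u) / kappa ^+ 2 * e + (2 / u)^-1 * u.
have sup v : walk_law m x v <= Num.sqrt b.
  have [->|nz] := eqVneq (walk_law m x v) 0; first exact: sqrtr_ge0.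
  rewrite -[leLHS]ger0_norm ?walk_law_ge0// -sqrtr_sqr ler_wsqrtr//.
  by apply: sup_norm_energy; rewrite ?divr_gt0// (walk_law_orbit nz).
have uM : u <= Num.sqrt b.
  rewrite -[leRHS]mulr1 -(fsumT_walk_law m x) -fsumT_scale.
  apply: ler_fsumT; [|exact: fs_mulr|move=> v].
    by apply: (@fs_comp (fun x => x ^+ 2)); rewrite ?expr0n.
  by rewrite expr2 ler_wpM2r ?walk_law_ge0.
have b0 : 0 <= b.
  by rewrite addr_ge0// mulr_ge0 ?invr_ge0 ?divr_ge0 ?mulr_ge0 ?invr_ge0 // ltW.
have : u ^+ 2 <= b.
  by rewrite -(sqr_sqrtr b0) ler_pXn2r ?nnegrE ?sqrtr_ge0.
have -> : b = 4 * e / (kappa ^+ 2 * u) + u ^+ 2 / 2.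
  by rewrite /b; field; rewrite un0 gt_eqF.
move=> h.
have : u ^+ 2 / 2 <= 4 * e / (kappa ^+ 2 * u) by lra.
rewrite ler_pdivlMr ?mulr_gt0//; nra.
Qed.

Lemma kappa_le1 : kappa <= 1.
Proof.
case E : letters mu_sum => [|a l].
  by rewrite big_nil => /eqP; rewrite eq_sym oner_eq0.
move=> <-; rewrite big_cons -[leLHS]addr0 lerD ?kappa_le ?E ?mem_head//.
exact: sumr_ge0.
Qed.

(** A discrete form of [u' <= - kappa^2 u^3 / 8], whose solutions satisfy
[kappa^2 * (n + const) * u^2 <= 4]. The decay forces [z = kappa^2 * a^2 <= 8]
unless [b] vanishes, and then [(4 + z) * (1 - z / 8)^2 <= 4]. *)
Lemma cubic_decay_step (n a b : R) : 0 <= b -> 0 <= n -> 0 <= a ->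
  b <= a - kappa ^+ 2 * a ^+ 3 / 8 -> kappa ^+ 2 * n * a ^+ 2 <= 4 ->
  kappa ^+ 2 * (n + 1) * b ^+ 2 <= 4.
Proof.
move=> b0 n0 a0 ba na.
have [z8|z8] := leP (kappa ^+ 2 * a ^+ 2) 8; last first.
  have : b <= a * (1 - kappa ^+ 2 * a ^+ 2 / 8) by apply: le_trans ba _; lra.
  move=> /(le_trans b0) h; have -> : b = 0; last by rewrite expr0n mulr0.
  by nra.
set z := kappa ^+ 2 * a ^+ 2 in z8.
have kappa2 : 0 <= kappa ^+ 2 by rewrite exprn_ge0// ltW.
have z0 : 0 <= z by rewrite mulr_ge0// exprn_ge0.
have ba' : b <= a * (1 - z / 8) by apply: le_trans ba _; rewrite /z; lra.
have b2 : b ^+ 2 <= (a * (1 - z / 8)) ^+ 2.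
  by rewrite lerXn2r ?nnegrE// (le_trans b0).
have hn : 0 <= n + 1 by rewrite addr_ge0.
apply: (@le_trans _ _ (kappa ^+ 2 * (n + 1) * (a * (1 - z / 8)) ^+ 2)).
  by rewrite ler_wpM2l// mulr_ge0.
have -> : kappa ^+ 2 * (n + 1) * (a * (1 - z / 8)) ^+ 2 =
    (kappa ^+ 2 * n * a ^+ 2 + z) * (1 - z / 8) ^+ 2 by rewrite /z; ring.
apply: (@le_trans _ _ ((4 + z) * (1 - z / 8) ^+ 2)).
  by rewrite ler_wpM2r ?sqr_ge0// lerD2r.
have -> : (4 + z) * (1 - z / 8) ^+ 2 = 4 - z ^+ 2 * (12 - z) / 64 by field.
by rewrite gerBl divr_ge0// mulr_ge0 ?sqr_ge0//; lra.
Qed.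

(** The offset [4] is the largest one allowed at time [0], where the mass is
[1] and [kappa <= 1]. It makes the bound strong enough at small times for even
and odd times to be treated together below. *)
Lemma return_mass_bound m x : infinite_set (walk_orbit x) ->
  kappa ^+ 2 * (m + 4)%:R * return_mass m x ^+ 2 <= 4.
Proof.
move=> oinf; elim: m => [|m IH].
  have -> : return_mass 0 x = 1.
    rewrite -(fsumT_point_mass (fun=> 1) x); apply: eq_fsumT => v.
    by rewrite /walk_law/= /point_mass mul1r; case: eqP; rewrite ?expr0n ?expr1n.
  rewrite expr1n mulr1 add0n; have := kappa_le1; have := kappa_gt0; nra.
rewrite addSn -natr1; apply: cubic_decay_step IH => //; rewrite ?return_mass_ge0//.
exact: return_mass_decay.
Qed.

(** The time is split into two halves, one run from each end, and the product
of the two laws is bounded by the mean of their squares. *)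
Lemma walk_law_decay n x y :
  infinite_set (walk_orbit x) -> infinite_set (walk_orbit y) ->
  kappa ^+ 2 * n%:R * walk_law n x y ^+ 2 <= 16.
Proof.
move=> ox oy; set p := walk_law n x y.
pose m := n./2; pose m' := uphalf n.
have nE : (m' + m = n)%N.
  by rewrite /m /m' addnC -[RHS]odd_double_half uphalf_half; lia.
have ux := return_mass_bound m ox.
have uy := return_mass_bound m' oy.
have p0 : 0 <= p by exact: walk_law_ge0.
have pu : p <= 2^-1 * (return_mass m x + return_mass m' y).
  rewrite /p -nE -walk_law_convolution -fsumTD; first last.
  - by apply: (@fs_comp (fun x => x ^+ 2)); rewrite ?expr0n//; exact: fs_walk_law.
  - by apply: (@fs_comp (fun x => x ^+ 2)); rewrite ?expr0n//; exact: fs_walk_law.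
  rewrite -fsumT_scale; apply: ler_fsumT.
  - exact/fs_mull/fs_walk_law.
  - apply/fs_mulr/fs_add;
    by apply: (@fs_comp (fun x => x ^+ 2)); rewrite ?expr0n//; exact: fs_walk_law.
  move=> v; rewrite -subr_ge0.
  rewrite (_ : _ - _ = 2^-1 * (walk_law m x v - walk_law m' y v) ^+ 2).
    by rewrite mulr_ge0 ?sqr_ge0.
  by field.
have p2 : p ^+ 2 <= 2^-1 * (return_mass m x ^+ 2 + return_mass m' y ^+ 2).
  have : p ^+ 2 <= (2^-1 * (return_mass m x + return_mass m' y)) ^+ 2.
    by rewrite lerXn2r ?nnegrE// (le_trans p0).
  by have := sqr_ge0 (return_mass m x - return_mass m' y); lra.
have nm : n%:R <= 2 * (m + 4)%:R :> R by rewrite -natrM ler_nat; lia.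
have nm' : n%:R <= 2 * (m' + 4)%:R :> R by rewrite -natrM ler_nat; lia.
have kappa2 : 0 <= kappa ^+ 2 by rewrite exprn_ge0// ltW.
have hx : kappa ^+ 2 * n%:R * return_mass m x ^+ 2 <= 8.
  rewrite (@le_trans _ _ (kappa ^+ 2 * (2 * (m + 4)%:R) * return_mass m x ^+ 2))//.
    by rewrite ler_wpM2r ?sqr_ge0// ler_wpM2l.
  by move: ux; lra.
have hy : kappa ^+ 2 * n%:R * return_mass m' y ^+ 2 <= 8.
  rewrite (@le_trans _ _ (kappa ^+ 2 * (2 * (m' + 4)%:R) * return_mass m' y ^+ 2))//.
    by rewrite ler_wpM2r ?sqr_ge0// ler_wpM2l.
  by move: uy; lra.
have : kappa ^+ 2 * n%:R * p ^+ 2 <=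
    kappa ^+ 2 * n%:R * (2^-1 * (return_mass m x ^+ 2 + return_mass m' y ^+ 2)).
  by rewrite ler_wpM2l// mulr_ge0.
by lra.
Qed.

End Walk.

(** * Right translation of cosets *)

Section Cosets.
Context {G : groupType}.
Implicit Types (A H : set G) (g h : G).

Lemma right_coset1 A : right_coset A 1%g = A.
Proof.
by apply/seteqP; split=> [_ [a Aa <-]|a Aa]; [|exists a]; rewrite ?mulg1.
Qed.

Lemma right_cosetM A g h :
  right_coset A (g * h)%g = right_coset (right_coset A g) h.
Proof.
apply/seteqP; split=> [_ [a Aa <-]|_ [_ [a Aa <-] <-]].
  by exists (a * g)%g; [exists a|rewrite mulgA].
by exists a => //; rewrite mulgA.
Qed.

Lemma mem_right_coset A g h : right_coset A g h <-> A (h * g^-1)%g.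
Proof.
split=> [[a Aa <-]|Ahg]; first by rewrite -mulgA mulgV mulg1.
by exists (h * g^-1)%g => //; rewrite -mulgA mulVg mulg1.
Qed.

(** Among the cosets of [H], only [H] contains the identity: this identifies
the starting law of the projected walk with a point mass. *)
Lemma right_coset_eqH H g : is_subgroup H ->
  (right_coset H g 1%g) <-> right_coset H g = H.
Proof.
move=> HG; have [H1 HD] := HG.
have HM := group_closedM HG; have HV := group_closedV HG.
rewrite !inE in H1; split=> [/mem_right_coset|->//]; rewrite mul1g => Hg.
have Hg' : H g by rewrite -in_setE -[g]invgK; apply/HV/mem_set.
apply/seteqP; split=> [_ [a Ha <-]|a Ha].
  by rewrite -in_setE; apply: HM; exact: mem_set.
apply/mem_right_coset; rewrite -in_setE; apply: HM; exact: mem_set.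
Qed.

Lemma subgroup1 : is_subgroup [set 1%g : G].
Proof.
split; first by rewrite inE.
by move=> x y; rewrite !inE /= => -> ->; rewrite mulgV.
Qed.

Lemma right_coset_set1 g : right_coset [set 1%g] g = [set g].
Proof.
by apply/seteqP; split=> [_ [_ -> <-]|_ ->] /=; [|exists 1%g]; rewrite ?mul1g.
Qed.

Lemma infinite_index1 : infinite_set [set: G] -> infinite_index [set 1%g : G].
Proof.
apply: contra_not => fin; apply: (@sub_finite_set _ _
  [set g | range (right_coset [set 1%g]) [set g]]).
  by move=> g _; exists g => //; exact: right_coset_set1.
by apply: finite_preimage fin => g h _ _ /= gh; rewrite -[g = h]/([set h] g) -gh.
Qed.

End Cosets.

(** * Words and balls *)

Section Words.
Context {G : groupType}.
Variable S : set G.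
Hypothesis S_finite : finite_set S.
Hypothesis S_gen : generates_as_semigroup S.

Definition words n : set G := [set g | exists s, size s = n /\ is_word S s g].

Lemma finite_words n : finite_set (words n).
Proof.
elim: n => [|n IH].
  apply: (@sub_finite_set _ _ [set 1%g]) => [g [s [/size0nil -> [_ <-]]]|].
    by rewrite big_nil.
  exact: finite_set1.
apply: sub_finite_set (finite_image2 (fun a b => a * b)%g S_finite IH).
move=> g [[|a s] [// [sz] [sS <-]]]; rewrite big_cons.
exists a; first by apply: sS; rewrite /= mem_head.
exists (\prod_(x <- s) x)%g => //; exists s; split => //; split => // x xs.
by apply: sS; rewrite /= in_cons xs orbT.
Qed.

Lemma countable_of_generates : countable [set: G].
Proof.
apply: (@sub_countable _ _ _ (\bigcup_n words n)).
  apply: subset_card_le => g _; have [s _ sg] := S_gen g.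
  by exists (size s) => //; exists s.
by apply: bigcup_countable => // n _; apply: finite_set_countable (finite_words n).
Qed.

Lemma finite_word_ball r : finite_set (word_ball S r).
Proof.
apply: (@sub_finite_set _ _ (\bigcup_(n in `I_r.+1) words n)); last first.
  by apply: bigcup_finite => // n _; exact: finite_words.
move=> g; rewrite /word_ball /= => gr; exists (word_length S g) => //.
have : [set size s | s in [set s | is_word S s g]] !=set0.
  by have [s _ sg] := S_gen g; exists (size s), s.
by move=> /set_min_nat[[s sg sz] _]; exists s.
Qed.

End Words.

(** * The law of the random walk *)

Section Law.
Context {R : realType} {G : groupType}.
Variables (mu : G -> R) (L : {fset G}).
Hypothesis mu_sum : \sum_(s <- L) mu s = 1.
Context {d : measure_display} {Omega : measurableType d}.
Variables (P : probability Omega R) (X : nat -> Omega -> G).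
Hypothesis X_iid : iid_with_law P mu X.
Hypothesis G_countable : countable [set: G].

(** The step operator acts here on functions of arbitrary subsets: the
probability that [Z_n] lies in [A] satisfies the recursion of the walk for right
translation, from the indicator of the subsets that contain the identity. *)
Definition set_law (n : nat) : set G -> R :=
  iter n (walk_step (@right_coset G) mu L) (fun A => (1%g \in A)%:R).

Lemma random_walkS n w :
  random_walk X n.+1 w = (random_walk X n w * X n w)%g.
Proof. by rewrite /random_walk big_ord_recr. Qed.

(** Countability of the group is what makes this hold: the event is a union over
all values of the last step. *)
Lemma measurable_random_walk n (A : set G) :
  measurable [set w | A (random_walk X n w)].
Proof.
have [Xm _ _] := X_iid.
elim: n A => [|n IH] A.
  rewrite (_ : [set _ | _] = [set _ | A 1%g]).
    have [A1|A1] := pselect (A 1%g).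
      by rewrite (_ : [set _ | _] = setT)//; apply/seteqP; split.
    by rewrite (_ : [set _ | _] = set0)//; apply/seteqP; split.
  by apply/seteqP; split=> w; rewrite /random_walk /= big_ord0.
rewrite (_ : [set _ | _] = \bigcup_(g in [set: G])
    (X n @^-1` [set g] `&` [set w | right_coset A g^-1%g (random_walk X n w)])).
  by apply: countable_bigcupT_measurable => // g; apply: measurableI => //; exact: Xm.
apply/seteqP; split=> w /=; rewrite random_walkS.
  by exists (X n w) => //; split => //; apply/mem_right_coset; rewrite invgK.
by move=> [g _ [/= <- /mem_right_coset]]; rewrite invgK.
Qed.

Let future (J : {fset nat}) (A : nat -> set G) :=
  \bigcap_(j in [set` J]) (X j @^-1` A j).

Lemma measurable_future (J : {fset nat}) A : measurable (future J A).
Proof.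
have [Xm _ _] := X_iid.
by apply: bigcap_measurableType => j _; exact: Xm.
Qed.

Lemma letters_full n : P (~` (X n @^-1` [set` L])) = 0%E.
Proof.
have [Xm Xl _] := X_iid.
rewrite probability_setC; last exact: Xm.
rewrite (_ : X n @^-1` [set` L] = \bigcup_(s in [set` L]) (X n @^-1` [set s])).
  rewrite measure_fin_bigcup//; last by move=> s t _ _ [w [/= <- <-]].
  rewrite -fsbig_seq// (eq_bigr (fun s => (mu s)%:E)); last by move=> s _; exact: Xl.
  by rewrite sumEFin mu_sum subee.
by apply/seteqP; split=> w /= => [wL|[s sL ->]//]; exists (X n w).
Qed.

(** Independence of the position at time [n] from all later steps, together
with its law: the last letter is split off and joins the later steps, which
is why the induction must carry an arbitrary event of the future. *)
Lemma random_walk_joint_law n (J : {fset nat}) (A : nat -> set G) (C : set G) :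
  (forall j, j \in J -> (n <= j)%N) ->
  P ([set w | C (random_walk X n w)] `&` future J A) =
  ((set_law n C)%:E * \prod_(j <- J) P (X j @^-1` A j))%E.
Proof.
have [Xm Xl Xi] := X_iid.
elim: n J A C => [|n IH] J A C nJ.
  rewrite -Xi /set_law /=.
  have [C1|C1] := boolP (1%g \in C).
    rewrite mul1e; congr (P _); apply/seteqP; split=> w; first by case.
    by move=> Bw; split => //=; rewrite /random_walk big_ord0 -in_setE.
  rewrite mul0e -(measure0 P); congr (P _); apply/seteqP; split=> w //= [].
  by rewrite /random_walk big_ord0 -in_setE (negPf C1).
set E := _ `&` _.
have mE : measurable E.
  by apply: measurableI; [exact: measurable_random_walk|exact: measurable_future].
(* The event splits over the value [s] of the step [n], which joins the
   future; the steps outside [L] have probability zero. *)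
pose A' s j := if j == n then [set s] else A j.
have nnJ : n \notin J by apply/negP => /nJ; rewrite ltnn.
pose Es s := [set w | right_coset C s^-1%g (random_walk X n w)]
  `&` future (n |` J)%fset (A' s).
have mEs s : measurable (Es s).
  by apply: measurableI; [exact: measurable_random_walk|exact: measurable_future].
have EsE s : Es s = E `&` X n @^-1` [set s].
  apply/seteqP; split=> w /=.
    move=> [/mem_right_coset]; rewrite invgK => Cw Bw.
    have Xn : X n w = s by have := Bw n; rewrite /= /A' eqxx; apply; rewrite !inE eqxx.
    split => //; split; first by rewrite /= random_walkS Xn.
    move=> j /= jJ; have := Bw j; rewrite /= /A'; case: eqP => [jn|_].
      by move: jJ; rewrite jn (negPf nnJ).
    by apply; rewrite !inE jJ orbT.
  move=> [[/=]]; rewrite random_walkS => Cw Bw Xn; split=> /=.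
    by apply/mem_right_coset; rewrite invgK -Xn.
  move=> j /=; rewrite !inE /A'; case: eqP => [->//|_ /= jJ]; exact: Bw.
have PE : P E = P (\bigcup_(s in [set` L]) Es s).
  rewrite -[RHS](measureU0 (B := E `&` ~` (X n @^-1` [set` L]))).
  - congr (P _); apply/seteqP; split=> w.
      move=> Ew; have [wL|wL] := pselect ([set` L] (X n w)).
        by left; exists (X n w) => //; rewrite EsE.
      by right.
    by move=> [[s _]|[]//]; rewrite EsE => -[].
  - by apply: fin_bigcup_measurable => // s _; exact: mEs.
  - by apply: measurableI => //; apply: measurableC; exact: Xm.
  apply: (subset_measure0 _ _ _ (letters_full n)) => //.
  - by apply: measurableI => //; apply: measurableC; exact: Xm.
  - by apply: measurableC; exact: Xm.
have PEs s : P (Es s) =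
    ((mu s * set_law n (right_coset C s^-1%g))%:E * \prod_(j <- J) P (X j @^-1` A j))%E.
  rewrite IH; last by move=> j; rewrite !inE => /orP[/eqP ->//|/nJ /ltnW].
  rewrite big_fsetU1//= /A' eqxx Xl muleA -EFinM mulrC; congr (_ * _)%E.
  rewrite big_seq [RHS]big_seq; apply: eq_bigr => j jJ.
  by case: eqP => // jn; move: jJ; rewrite jn (negPf nnJ).
rewrite PE measure_fin_bigcup//; last first.
  by move=> s t _ _ [w []]; rewrite !EsE => -[_ /= <-] [_ /= <-].
rewrite -fsbig_seq// (eq_bigr _ (fun s _ => PEs s)).
have pf : (\prod_(j <- J) P (X j @^-1` A j))%E \is a fin_num.
  by rewrite -Xi fin_num_measure//; exact: measurable_future.
rewrite -(fineK pf); under eq_bigr do rewrite -EFinM.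
by rewrite sumEFin -EFinM -mulr_suml.
Qed.

Lemma random_walk_law n (C : set G) :
  P [set w | C (random_walk X n w)] = (set_law n C)%:E.
Proof.
have := @random_walk_joint_law n fset0 (fun=> setT) C.
rewrite big_seq_fset0 mule1 => <-; last by move=> j; rewrite inE.
by congr (P _); rewrite /future set_fset0 bigcap_set0 setIT.
Qed.

(** On the cosets of a subgroup the law of the walk on the group is the law of
the projected walk, started at the subgroup itself. *)
Lemma set_law_coset n (H : set G) g : is_subgroup H ->
  set_law n (right_coset H g) =
  walk_law (@right_coset G) mu L n H (right_coset H g).
Proof.
move=> HG; elim: n g => [|n IH] g.
  rewrite /set_law /walk_law /= /point_mass; congr (_%:R); congr nat_of_bool.
  by apply/idP/eqP; [rewrite inE => /right_coset_eqH; apply|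
    move=> gH; rewrite inE; apply/right_coset_eqH].
apply: eq_bigr => s _; rewrite -right_cosetM; congr (_ * _); exact: IH.
Qed.

End Law.

(** * Least mass and optimal coverings *)

Lemma set_min_finite (R : realType) (A : set R) :
  finite_set A -> A !=set0 -> is_min A (set_min 0 A).
Proof.
move=> finA [a Aa]; apply: xgetPex.
have aA : a \in fset_set A by rewrite in_fset_set ?inE.
case: (@arg_minP _ _ _ [` aA]%fset xpredT val isT) => m _ mmin.
exists (val m); split=> [|x Ax].
  by have := fsvalP m; rewrite in_fset_set// inE.
have xA : x \in fset_set A by rewrite in_fset_set ?inE.
exact: (mmin [` xA]%fset).
Qed.

Section MinMass.
Context {R : realType} {G : groupType}.
Variable mu : G -> R.
Hypothesis mu_prob : is_finsupp_prob mu.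

Lemma min_massP : 0 < min_mass mu /\ forall s, supp mu s -> min_mass mu <= mu s.
Proof.
have [_ fin sum1] := mu_prob.
have ne : [set mu g | g in supp mu] !=set0.
  have [[g gs]|/forallNP no] := pselect (exists g, supp mu g); first by exists (mu g), g.
  by move: sum1; rewrite fsbig1 => [/eqP|g /no//]; rewrite eq_sym oner_eq0.
have [[g gs gE] lb] := set_min_finite (finite_image mu fin) ne.
by split=> [|s ss]; [rewrite /min_mass -gE|apply: lb; exists s].
Qed.

End MinMass.

(** A finite ball is covered by its points, which are cosets of the trivial
subgroup, so the minimum that defines the covering function is attained. *)
Lemma coset_covering_attained (G : groupType) (S : set G) (r : nat) :
  infinite_set [set: G] -> finite_set S -> generates_as_semigroup S ->
  exists C : 'I_(coset_covering S r) -> set G,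
    (forall i, is_cii (C i)) /\ word_ball S r `<=` \bigcup_i C i.
Proof.
move=> Ginf Sfin Sgen.
suff /set_min_nat[] : [set N | exists C : 'I_N -> set G,
    (forall i, is_cii (C i)) /\ word_ball S r `<=` \bigcup_i C i] !=set0 by [].
have Bfin := finite_word_ball Sfin Sgen r.
pose s : seq G := fset_set (word_ball S r).
exists (size s), (fun i => [set tnth (in_tuple s) i]); split=> [i|g Bg].
  exists [set 1%g], (tnth (in_tuple s) i); rewrite right_coset_set1.
  by split; [exact: subgroup1|exact: infinite_index1|].
have gs : g \in s by rewrite in_fset_set ?inE.
have gi : (index g s < size s)%N by rewrite index_mem.
by exists (Ordinal gi) => //=; rewrite (tnth_nth g) /= nth_index.
Qed.

(** * Probability of cosets *)

Section CosetProbability.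
Context {R : realType} {G : groupType}.
Variable mu : G -> R.
Hypothesis mu_prob : is_finsupp_prob mu.
Hypothesis mu_sym : symmetric_mass mu.
Hypothesis mu_nondeg : nondegenerate_mass mu.
Context {d : measure_display} {Omega : measurableType d}.
Variables (P : probability Omega R) (X : nat -> Omega -> G).
Hypothesis X_iid : iid_with_law P mu X.

Let L := fset_set (supp mu).

Let supp_fin : finite_set (supp mu). Proof. by have [] := mu_prob. Qed.

Let in_L s : (s \in (L : seq G)) = (s \in supp mu).
Proof. exact: in_fset_set. Qed.

Let mu_sum : \sum_(s <- L) mu s = 1.
Proof. by have [_ fin <-] := mu_prob; rewrite fsbig_finite. Qed.

Let G_countable : countable [set: G].
Proof. exact: countable_of_generates supp_fin mu_nondeg. Qed.

Let walk_prob n (C : set G) :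
  P [set w | C (random_walk X n w)] = (set_law mu L n C)%:E.
Proof. exact: random_walk_law. Qed.

Lemma cii_probability_le n (C : set G) : is_cii C ->
  (P [set w | C (random_walk X n w)]
    * (min_mass mu * Num.sqrt n%:R)%:E <= 4%:E)%E.
Proof.
move=> [H [g [HG Hinf ->]]].
have [mu0 _ _] := mu_prob; have [k0 kle] := min_massP mu_prob.
rewrite walk_prob -EFinM lee_fin set_law_coset//.
have p0 : 0 <= walk_law (@right_coset G) mu L n H (right_coset H g).
  exact: walk_law_ge0.
have orbH : infinite_set (walk_orbit (@right_coset G) H) by [].
have orbHg : infinite_set (walk_orbit (@right_coset G) (right_coset H g)).
  by rewrite walk_orbit_act; last exact: right_cosetM.
have := @walk_law_decay R (set G) G (@right_coset G) (@right_coset1 G)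
  (@right_cosetM G) mu L mu0 mu_sum mu_sym (fset_uniq L) _ (min_mass mu) k0 _ _
  n H (right_coset H g) orbH orbHg.
have h1 s : s \in (L : seq G) -> s^-1%g \in (L : seq G).
  by rewrite !in_L !inE /supp /= -mu_sym.
have h2 s : s \in (L : seq G) -> min_mass mu <= mu s.
  by rewrite in_L inE; exact: kle.
have h3 (h : G) : exists w : seq G, all (mem (L : seq G)) w /\ (\prod_(x <- w) x)%g = h.
  have [w _ [wS wE]] := mu_nondeg h; exists w; split=> //.
  by apply/allP => x /wS xS; rewrite inE in_L inE.
move=> /(_ h1 h2 h3) bound.
have m0 := ltW k0.
rewrite -(@ler_pXn2r _ 2) ?nnegrE ?mulr_ge0 ?sqrtr_ge0//.
by rewrite !exprMn sqr_sqrtr ?ler0n//; lra.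
Qed.

Lemma ball_probability_covering n r c : 0 < c ->
  infinite_set [set: G] ->
  (c%:E < P [set w | word_ball (supp mu) r (random_walk X n w)])%E ->
  c * min_mass mu / 4 * Num.sqrt n%:R <= (coset_covering (supp mu) r)%:R.
Proof.
move=> c0 Ginf cP.
have [C [Ccii Ccov]] := coset_covering_attained r Ginf supp_fin mu_nondeg.
move: C Ccii Ccov; set N := coset_covering _ _ => C Ccii Ccov.
have mW (A : set G) : measurable [set w | A (random_walk X n w)].
  exact: (measurable_random_walk X_iid G_countable).
(* Events indexed by all naturals, empty beyond [N], for the union bound. *)
pose F i := [set w | exists h : (i < N)%N, C (Ordinal h) (random_walk X n w)].
have FE (i : 'I_N) : F i = [set w | C i (random_walk X n w)].
  apply/seteqP; split=> w /= => [[h]|Cw]; last exists (ltn_ord i).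
    by rewrite (_ : Ordinal h = i)//; exact: val_inj.
  by rewrite (_ : Ordinal _ = i)//; exact: val_inj.
have mF i : (i < N)%N -> measurable (F i).
  by move=> iN; rewrite (FE (Ordinal iN)).
have cS : (c%:E <= \sum_(i < N) P (F i))%E.
  apply: le_trans (ltW cP) _; apply: le_trans (Boole_inequality P mF).
  apply: le_measure; rewrite ?inE //.
    by apply: bigsetU_measurable => i _; exact: mF.
  move=> w /= /Ccov[i _ Ci]; rewrite -bigcup_mkord.
  by exists (val i); [exact: ltn_ord|rewrite FE].
have [k0 _] := min_massP mu_prob.
have kn : 0 <= min_mass mu * Num.sqrt n%:R by rewrite mulr_ge0 ?sqrtr_ge0// ltW.
have : (c%:E * (min_mass mu * Num.sqrt n%:R)%:E <= (4 * N%:R)%:E)%E.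
  apply: (@le_trans _ _ ((\sum_(i < N) P (F i))
      * (min_mass mu * Num.sqrt n%:R)%:E)%E); first exact: lee_wpmul2r.
  rewrite ge0_sume_distrl//; apply: (@le_trans _ _ (\sum_(i < N) 4%:E)%E).
    by apply: lee_sum => i _; rewrite FE; exact: cii_probability_le.
  by rewrite sumEFin lee_fin sumr_const card_ord mulr_natr.
by rewrite -EFinM lee_fin; lra.
Qed.

End CosetProbability.

Unset Implicit Arguments.

Theorem theorem3p1 (R : realType) (G : groupType)
    (G_infinite : infinite_set [set: G]) (G_fg : finitely_generated G)
    (mu : G -> R) (mu_prob : is_finsupp_prob mu)
    (mu_sym : symmetric_mass mu) (mu_nondeg : nondegenerate_mass mu)
    (d : measure_display) (Omega : measurableType d) (P : probability Omega R)
    (X : nat -> Omega -> G) (X_iid : iid_with_law P mu X)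
    (f : nat -> nat) (f_mono : {homo f : m n / (m <= n)%N}) (c : R)
    (c_gt0 : 0 < c)
    (walk_in_ball : forall n : nat,
      (c%:E < P [set w | word_ball (supp mu) (f n) (random_walk X n w)])%E) :
  forall r : nat, [set k | (f k <= r)%N] !=set0 ->
    exists2 fstar : nat, is_max [set k | (f k <= r)%N] fstar &
      (coset_covering (supp mu) r)%:R >=
        c * min_mass mu / 4 * Num.sqrt (fstar%:R : R).
Proof.
move=> r ne; set N := coset_covering _ r.
have bound k : (f k <= r)%N -> c * min_mass mu / 4 * Num.sqrt k%:R <= N%:R.
  move=> fk; apply: (ball_probability_covering mu_prob mu_sym mu_nondeg X_iid) => //.
  apply: lt_le_trans (walk_in_ball k) _.
  have mW := measurable_random_walk X_iid
    (countable_of_generates (let: And3 _ fin _ := mu_prob in fin) mu_nondeg) k.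
  by apply: le_measure; rewrite ?inE//= => w /leq_trans; apply.
have [mm0 _] := min_massP mu_prob.
set a := c * min_mass mu / 4 in bound *.
have a0 : 0 < a by rewrite divr_gt0// mulr_gt0.
have ub k : (f k <= r)%N -> (k <= Num.bound ((N%:R / a) ^+ 2))%N.
  move=> /bound; rewrite mulrC -ler_pdivlMr// => kle.
  have /ltW := archi_boundP (sqr_ge0 (N%:R / a)).
  move/(le_trans _) => h; rewrite -(ler_nat R); apply: h.
  rewrite -[leLHS]sqr_sqrtr ?ler0n// lerXn2r ?nnegrE ?sqrtr_ge0//.
  by rewrite (le_trans _ kle) ?sqrtr_ge0.
have [k fk kmax] := ex_maxnP ne ub.
exists k; last exact: bound.
by split=> // j; exact: kmax.
Qed.
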